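(* Let $W$ be a vector space over an infinite field $K$ with $\dim(W)\ge 2^{|K|}$. If $\kappa$ is a cardinal number with $2\le\kappa\le |W|$, then there exists a star-like family $\mathcal{F}\subsetneq W$ containing $0$ such that $A(\mathcal{F})=\kappa$ and $m\mathcal{L}(\mathcal{F})=\dim(W)$ (so that $\mathcal{L}(\mathcal{F})=\dim(W)^+$).
   Context: For a cardinal $\kappa$, $\kappa^+$ denotes its cardinal successor, and $|F|$ denotes the cardinality of a set $F$. Let $W$ be a vector space over a field $K$ and $M\subset W$. - $\mathrm{st}(M)=\{w\in W\colon cw\in M \text{ for all } c\in K\setminus\{0\}\}$; $M$ is star-like if $\mathrm{st}(M)=M$. - Lineability number: $\mathcal{L}(M)=\min\{\kappa\colon M\cup\{0\} \text{ contains no vector subspace of dimension } \kappa\}$ ($\kappa$ ranging over cardinals). - Maximal lineability number: $m\mathcal{L}(M)=\min\{\dim(V)\colon V \text{ is a maximal (with respect to inclusion) linear subspace contained in } M\cup\{0\}\}$. - Additivity number: $A(M)=A(M,W)=\min\bigl(\{|F|\colon F\subset W \text{ and } (\forall w\in W)(w+F\not\subset M)\}\cup\{|W|^+\}\bigr)$, where $w+F=\{w+f\colon f\in F\}$. *)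

(* Defs.v *)
From HB Require Import structures.
From mathcomp Require Import all_boot all_order all_algebra.
From mathcomp Require Import boolp classical_sets functions cardinality.

Set Implicit Arguments.
Unset Strict Implicit.
Unset Printing Implicit Defensive.

Import GRing.Theory.
Local Open Scope classical_set_scope.
Local Open Scope card_scope.
Local Open Scope ring_scope.

(* A cardinal is represented by a type, considered up to equipotence; it is
   compared with the cardinality of a set through [#<=] and [#=].  Cardinal
   invariants are relations between an object and such a type. *)

Definition least_cardinal (P : Type -> Prop) (k : Type) : Prop :=
  P k /\ forall l : Type, P l -> [set: k] #<= [set: l].

Definition cardinal_lt (k l : Type) : Prop :=
  [set: k] #<= [set: l] /\ ~ ([set: l] #<= [set: k]).

Definition is_successor (k s : Type) : Prop :=
  least_cardinal (cardinal_lt k) s.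

Section VectorSpace.
Variables (K : fieldType) (W : lmodType K).
Implicit Types (M V B F : set W) (k : Type).

Definition is_subspace V : Prop := submod_closed (mem V).

(* Hamel bases: only finite linear combinations occur. *)
Definition linearly_independent B : Prop :=
  forall (s : seq W) (c : W -> K), uniq s -> [set` s] `<=` B ->
    \sum_(v <- s) c v *: v = 0 -> forall v, v \in s -> c v = 0.

Definition linear_span B : set W :=
  [set w | exists (s : seq W) (c : W -> K),
      [set` s] `<=` B /\ w = \sum_(v <- s) c v *: v].

Definition is_basis V B : Prop :=
  linearly_independent B /\ linear_span B = V.

Definition has_dim V k : Prop :=
  exists B, is_basis V B /\ B #= [set: k].

Definition st M : set W :=
  [set w | forall c : K, c != 0 -> M (c *: w)].

Definition star_like M : Prop := st M = M.

Definition is_lineability_number M k : Prop :=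
  least_cardinal
    (fun l => ~ exists V, [/\ is_subspace V, V `<=` M `|` [set 0] & has_dim V l])
    k.

Definition maximal_subspace_in (N V : set W) : Prop :=
  [/\ is_subspace V, V `<=` N
    & forall V', is_subspace V' -> V' `<=` N -> V `<=` V' -> V' = V].

Definition is_maximal_lineability_number M k : Prop :=
  least_cardinal
    (fun l => exists V, maximal_subspace_in (M `|` [set 0]) V /\ has_dim V l) k.

Definition is_additivity_number M k : Prop :=
  least_cardinal
    (fun l =>
      (exists F, F #= [set: l] /\
         forall w : W, ~ ([set w + f | f in F] `<=` M))
      \/ is_successor W l) k.

End VectorSpace.

(* Main.v *)
Require Import Defs.
From HB Require Import structures.
From mathcomp Require Import all_boot all_order all_algebra.
From mathcomp Require Import boolp classical_sets functions cardinality.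

(* Let [U] be a space with [|U| <= d] containing a cone [C] of additivity [kappa]
   in [U].  Since [d * d = d], a basis of [W] maps onto [U] with [d] basis
   vectors over [0], and the linear extension [f] of this map has a kernel of
   cardinality at least [d].  The family
   [F = f^-1(C)] has additivity [kappa] too, and since it is invariant under
   translation by the kernel, every maximal subspace of [F] contains the kernel;
   as [|K| < d], a space of cardinality at least [d] has dimension at least [d].
   If [kappa <= |K|], take for [U] the functions [I -> K] whose range has fewer
   than [kappa] elements and for [C] those that vanish somewhere, where
   [I = kappa] if [kappa] is infinite and [|I| = kappa - 1] otherwise: a family
   of fewer than [kappa] functions is made to vanish at distinct points by one
   translation, while [kappa] distinct constants are not translated into [C] by
   a function whose range is smaller.  If [kappa > |K|], take for [U] a
   space of dimension [kappa] and for [C] the complement of a punctured line. *)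

Set Implicit Arguments.
Unset Strict Implicit.
Unset Printing Implicit Defensive.

Import GRing.Theory.
Local Open Scope classical_set_scope.
Local Open Scope card_scope.
Local Open Scope ring_scope.

(** * Cardinal arithmetic *)

Lemma card_le_injP T U (A : set T) (B : set U) :
  A #<= B <-> exists f : A -> B, injective f.
Proof.
split=> [/card_leP[f]|[f injf]]; first by exists f => x y; apply: inj; rewrite in_setE.
apply/card_leP; apply/injfunPex; exists f => //; exact: in2W.
Qed.

Lemma card_le_setTP T U :
  [set: T] #<= [set: U] <-> exists f : T -> U, injective f.
Proof.
rewrite card_le_injP; split=> -[f injf].
  exists (fun x => val (f (exist _ x (mem_set I)))) => x y /val_inj /injf.
  by case.
exists (fun x => exist _ (f (val x)) (mem_set I)) => x y [/injf]; exact: val_inj.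
Qed.

(** Choice turns the relation into an injection. A relation spares naming a function when the image
    depends on a proof of membership or on a chosen representation. *)
Lemma card_le_rel T U (A : set T) (B : set U) (R : T -> U -> Prop) :
  (forall a, A a -> exists b, B b /\ R a b) ->
  (forall a a' b, A a -> A a' -> R a b -> R a' b -> a = a') -> A #<= B.
Proof.
move=> totR injR.
have /choice[f fP] : forall a : A, exists b : B, R (val a) (val b).
  move=> a; have [b [Bb Rab]] := totR _ (set_mem (valP a)).
  by exists (exist _ b (mem_set Bb)).
apply/card_le_injP; exists f => a a' eq_f; apply: val_inj.
apply: (injR _ _ (val (f a))) => //; [exact: set_mem (valP a)|exact: set_mem (valP a')|].
by rewrite eq_f.
Qed.

Lemma card_le_inj T U (A : set T) (B : set U) (f : T -> U) :
  (forall a, A a -> B (f a)) ->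
  (forall a a', A a -> A a' -> f a = f a' -> a = a') -> A #<= B.
Proof.
move=> fAB injf; apply: (@card_le_rel _ _ _ _ (fun a b => f a = b)) => [a Aa|].
  by exists (f a); split=> //; exact: fAB.
by move=> a a' b Aa Aa' <- /esym; exact: injf.
Qed.

(* Hönig's argument: a maximal set of pairwise everywhere distinct elements of
   the product of the [A i] exhausts some [A i], which then injects in all the
   others. *)
Lemma card_le_min (I T : Type) (A : I -> set T) (i0 : I) :
  exists i, forall j, A i #<= A j.
Proof.
pose P (X : set (I -> T)) := (forall f j, X f -> A j (f j)) /\
  (forall f g j, X f -> X g -> f j = g j -> f = g).
have [|X [[XA Xinj] Xmax]] := @Zorn_bigcup _ P.
  move=> F FP Ftot; split=> [f j [X FX Xf]|f g j [X FX Xf] [Y FY Yg]].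
    by have [+ _] := FP X FX; apply.
  have [XY|YX] := Ftot _ _ FX FY.
    by have [_] := FP Y FY; apply=> //; apply: XY.
  by have [_] := FP X FX; apply=> //; apply: YX.
have [[i iP]|noi] := pselect (exists i, forall a, A i a -> exists2 f, X f & f i = a).
  exists i => j.
  apply: (@card_le_rel _ _ _ _ (fun a b => exists f, [/\ X f, f i = a & f j = b])).
    by move=> a /iP[f Xf fia]; exists (f j); split; [exact: XA|exists f].
  by move=> a a' b _ _ [f [Xf <- <-]] [g [Xg <- /Xinj-> ]].
have /choice[f fP] : forall i, exists a, A i a /\ forall g, X g -> g i <> a.
  move=> i; apply: contrapT => noa; apply: noi; exists i => a Aa.
  apply: contrapT => nof; apply: noa; exists a; split=> // g Xg gia.
  by apply: nof; exists g.
have nXf : ~ X f by move=> Xf; have [_ /(_ _ Xf)] := fP i0.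
case: (Xmax (X `|` [set f])).
  split=> [|sub]; first exact: subsetUl.
  by apply: nXf; apply: sub; right.
split=> [g j [/XA//|-> ]|g h j]; first by have [] := fP j.
case=> [Xg|->] [Xh|->] //; first exact: Xinj.
  by move=> eqj; have [_ /(_ _ Xg)] := fP j.
by move=> eqj; have [_ /(_ _ Xh)] := fP j; rewrite eqj.
Qed.

(** Comparability is [card_le_min] for a family of two sets; the sum type gives them a common
    carrier. *)
Lemma card_le_total T U (A : set T) (B : set U) : A #<= B \/ B #<= A.
Proof.
pose C (b : bool) : set (T + U) := if b then inl @` A else inr @` B.
have CA : C true #= A by apply: inj_card_eq => x y _ _ [].
have CB : C false #= B by apply: inj_card_eq => x y _ _ [].
have [[] leC] := card_le_min C true; [left|right].
  by rewrite -(card_le_eql CA) -(card_le_eqr CB).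
by rewrite -(card_le_eql CB) -(card_le_eqr CA).
Qed.

Lemma card_set_Nle T : ~ ([set: set T] #<= [set: T]).
Proof.
move=> /card_le_setTP[f injf].
pose D : set T := [set x | exists2 A, f A = x & ~ A x].
have nD : ~ D (f D) by move=> DfD; have [A /injf AD] := DfD; rewrite AD.
by apply: (nD); exists D.
Qed.

(** By Cantor the family of sets of subsets of [T] that do not embed in [T] is nonempty, so it has a
    smallest member. A competitor [l] below this member embeds in the power set of [T], hence is
    itself represented in the family. *)
Lemma successor_exists (T : Type) : exists s : Type, is_successor T s.
Proof.
pose N (A : set (set T)) := ~ (A #<= [set: T]).
have [s sP] := card_le_min (fun A : sig N => sval A) (exist N setT (@card_set_Nle T)).
exists (sval s); split=> [|l [Tl nlT]].
  rewrite /cardinal_lt (card_le_eql (card_setT _)) (card_le_eqr (card_setT _)).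
  by case: s sP => s ns _ /=; have [] := card_le_total s [set: T].
rewrite (card_le_eql (card_setT _)).
have [//|ls] := card_le_total (sval s) [set: l].
have /card_le_setTP[f injf] : [set: l] #<= [set: set T].
  by apply: card_le_trans ls _; exact: card_leT.
have fl : range f #= [set: l] by apply: inj_card_eq; exact: in2W.
have nf : ~ (range f #<= [set: T]) by rewrite (card_le_eql fl).
by rewrite -(card_le_eqr fl); exact: (sP (exist N _ nf)).
Qed.

(** * Products and finite sequences over infinite sets *)

Definition pairing_on T (A : set T) (f : T -> T -> T) :=
  (forall x y, A x -> A y -> A (f x y)) /\
  (forall x y x' y', A x -> A y -> A x' -> A y' ->
     f x y = f x' y' -> x = x' /\ y = y').

Lemma infinite_sub_pairing T : infinite_set [set: T] ->
  exists (A : set T) f, infinite_set A /\ pairing_on A f.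
Proof.
move=> /infiniteP/card_le_setTP[g injg].
have /choice[h hP] : forall x, exists n, forall m, g m = x -> m = n.
  move=> x; have [[n <-]|no] := pselect (exists n, g n = x).
    by exists n => m /injg.
  by exists 0%N => m gm; case: no; exists m.
have gK n : h (g n) = n by apply/esym/hP.
exists (range g), (fun x y => g (pickle (h x, h y))); split.
  by apply/infiniteP; apply/(card_le_inj (f := g)) => [n _|n m _ _ /injg//]; exists n.
split=> [x y _ _|x y x' y' [n _ <-] [m _ <-] [n' _ <-] [m' _ <-]]; first by eexists.
by rewrite !gK => /injg/(pcan_inj pickleK)[-> ->].
Qed.

Lemma pairing_extend T (A : set T) (f : T -> T -> T) (g : T -> T) :
  infinite_set A -> pairing_on A f ->
  (forall x, A x -> ~ A (g x)) ->
  (forall x y, A x -> A y -> g x = g y -> x = y) ->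
  exists f', pairing_on (A `|` g @` A) f' /\
    forall x y, A x -> A y -> f x y = f' x y.
Proof.
move=> /infiniteP/card_le_injP[e inje] [fA finj] gA ginj.
have eA n : A (val (e (exist _ n (mem_set I)))) by exact: set_mem (valP _).
(* The numbers a + 2b for bits a, b are distinct, which gives four tags in [A]. *)
pose t (a b : bool) := val (e (exist _ (a + b.*2)%N (mem_set I))).
have tA a b : A (t a b) by exact: eA.
have tinj a b a' b' : t a b = t a' b' -> a = a' /\ b = b'.
  by move=> /val_inj/inje/(congr1 val)/=; case: a a' b b' => [] [] [] [].
have /choice[p pP] : forall y, exists x, (A y -> x = y) /\ forall x', A x' -> g x' = y -> x = x'.
  move=> y; have [Ay|nAy] := pselect (A y).
    by exists y; split=> // x' /gA + eq_y; rewrite eq_y.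
  have [[x [Ax gx]]|no] := pselect (exists x, A x /\ g x = y).
    exists x; split=> // x' Ax' gx'; apply: ginj => //; by rewrite gx.
  by exists y; split=> // x' Ax' gx'; case: no; exists x'.
have pA x : A x -> p x = x by have [+ _] := pP x.
have pg x : A x -> p (g x) = x by move=> Ax; have [_] := pP (g x); apply.
have pAB x : (A `|` g @` A) x -> A (p x).
  by case=> [Ax|[z Az <-]]; [rewrite pA|rewrite pg].
have pinj x y : (A `|` g @` A) x -> (A `|` g @` A) y -> `[<A x>] = `[<A y>] ->
    p x = p y -> x = y.
  move=> [Ax|[z Az <-]] [Ay|[z' Az' <-]].
  - by rewrite !pA.
  - by rewrite (asboolT Ax) (asboolF (gA _ Az')).
  - by rewrite (asboolT Ay) (asboolF (gA _ Az)).
  - by rewrite !pg // => _ ->.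
(* The bits record in which half of [A `|` g @` A] the arguments lie; [p] folds
   both halves onto [A]. *)
pose q x y := f (t `[<A x>] `[<A y>]) (f (p x) (p y)).
have qA x y : (A `|` g @` A) x -> (A `|` g @` A) y -> A (q x y).
  by move=> *; apply: (fA) => //; apply: fA; exact: pAB.
exists (fun x y => if `[<A x /\ A y>] then f x y else g (q x y)); split; last first.
  by move=> x y Ax Ay; rewrite asboolT.
split=> [x y ABx ABy|x y x' y' ABx ABy ABx' ABy'].
  by case: asboolP => [[Ax Ay]|_]; [left; exact: fA|right; exists (q x y) => //; exact: qA].
case: asboolP => [[Ax Ay]|_]; case: asboolP => [[Ax' Ay']|_].
- exact: finj.
- by move=> eqf; case: (gA (q x' y')); [exact: qA|rewrite -eqf; exact: fA].
- by move=> eqf; case: (gA (q x y)); [exact: qA|rewrite eqf; exact: fA].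
- move=> /(ginj _ _ (qA _ _ ABx ABy) (qA _ _ ABx' ABy'))/finj[]//.
  + by apply: fA; apply: pAB.
  + by apply: fA; apply: pAB.
  + move=> /tinj[eqx eqy] /finj[]; try exact: pAB.
    by split; apply: pinj.
Qed.

(** Zorn's lemma yields a maximal pairing on an infinite subset [A]. Maximality forces the
    complement to embed in [A], so that [T] embeds in [A] and inherits its pairing. *)
Lemma infinite_pairing T : infinite_set [set: T] -> exists f : T * T -> T, injective f.
Proof.
move=> infT; have [A0 [f0 [infA0 pair0]]] := infinite_sub_pairing infT.
pose good (p : set T * (T -> T -> T)) := infinite_set p.1 /\ pairing_on p.1 p.2.
pose t0 : sig good := exist good (A0, f0) (conj infA0 pair0).
pose dom (t : sig good) := (sval t).1; pose fn (t : sig good) := (sval t).2.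
pose R (s t : sig good) :=
  `[< dom s `<=` dom t /\ forall x y, dom s x -> dom s y -> fn s x y = fn t x y >].
have [|r s t /asboolP[rs rsE] /asboolP[st stE]|F Ftot|] := @ZL_preorder _ t0 R.
- by move=> t; apply/asboolP; split.
- apply/asboolP; split=> [|x y rx ry]; first exact: subset_trans st.
  by rewrite rsE// stE//; exact: rs.
- have [[s0 Fs0]|F0] := pselect (exists s, F s); last first.
    by exists t0 => s Fs; case: F0; exists s.
  (* Members of the chain agree wherever two of them are defined, so [h] glues them. *)
  have /choice[h hP] : forall p : T * T, exists z, forall s, F s ->
      dom s p.1 -> dom s p.2 -> fn s p.1 p.2 = z.
    move=> p; have [[s [Fs s1 s2]]|no] :=
      pselect (exists s, [/\ F s, dom s p.1 & dom s p.2]); last first.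
      by exists p.1 => s Fs s1 s2; case: no; exists s.
    exists (fn s p.1 p.2) => s' Fs' s'1 s'2.
    by have [/asboolP[_ ->]|/asboolP[_ ->]] := Ftot _ _ Fs Fs'.
  have hE s x y : F s -> dom s x -> dom s y -> fn s x y = h (x, y).
    exact: (hP (x, y)).
  pose D := \bigcup_(s in F) dom s.
  have D2 x y : D x -> D y -> exists s, [/\ F s, dom s x & dom s y].
    move=> [s Fs sx] [s' Fs' s'y].
    have [/asboolP[ss' _]|/asboolP[s's _]] := Ftot _ _ Fs Fs'.
      by exists s'; split=> //; exact: ss'.
    by exists s; split=> //; exact: s's.
  have gD : good (D, fun x y => h (x, y)).
    split=> [|/=]; first by apply: sub_infinite_set (proj1 (svalP s0)) => x; exists s0.
    split=> [x y Dx Dy|x y x' y' Dx Dy Dx' Dy'].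
      have [s [Fs sx sy]] := D2 _ _ Dx Dy; rewrite -(hE s)//; exists s => //.
      by have [_ [+ _]] := svalP s; apply.
    have [s [Fs sx sy]] := D2 _ _ Dx Dy; have [s' [Fs' sx' sy']] := D2 _ _ Dx' Dy'.
    have [u [Fu ux uy ux' uy']] : exists u, [/\ F u, dom u x, dom u y, dom u x' & dom u y'].
      have [/asboolP[ss' _]|/asboolP[s's _]] := Ftot _ _ Fs Fs'.
        by exists s'; split=> //; exact: ss'.
      by exists s; split=> //; exact: s's.
    by rewrite -!(hE u)//; have [_ [_ inju]] := svalP u; exact: inju.
  exists (exist good _ gD) => s Fs; apply/asboolP; split=> [x sx|x y sx sy].
    by exists s.
  exact: hE.
move=> [[A f] [infA [fA finj]]] maxA.
(* If [A] embeds in its complement, the pairing extends, against maximality. *)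
have [/card_le_injP[g injg]|/card_le_injP[g injg]] := card_le_total A (~` A).
  have /choice[g' g'P] : forall x, exists y, forall Ax : A x,
      val (g (exist _ x (mem_set Ax))) = y.
    move=> x; have [Ax|nAx] := pselect (A x); last by exists x => Ax; case: (nAx Ax).
    exists (val (g (exist _ x (mem_set Ax)))) => Ax'.
    by rewrite (Prop_irrelevance Ax Ax').
  have gA x : A x -> ~ A (g' x).
    by move=> Ax; rewrite -(g'P x Ax); exact: set_mem (valP (g _)).
  have ginj x y : A x -> A y -> g' x = g' y -> x = y.
    by move=> Ax Ay; rewrite -(g'P x Ax) -(g'P y Ay) => /val_inj/injg[].
  have [f' [pair' ff']] := pairing_extend infA (conj fA finj) gA ginj.
  have good' : good (A `|` g' @` A, f').
    by split=> //; apply: (sub_infinite_set _ infA) => x; left.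
  have [|/= sub _] := asboolP _ (maxA (exist good _ good') _).
    by apply/asboolP; split=> [x|//]; left.
  have [x Ax] := infinite_setN0 infA.
  by case: (gA x Ax); apply: sub; right; exists x.
have /infiniteP/card_le_injP[e inje] := infA.
pose t (b : bool) := val (e (exist _ (b : nat) (mem_set I))).
have tA b : A (t b) by exact: set_mem (valP _).
have tinj b b' : t b = t b' -> b = b' by move=> /val_inj/inje[]; case: b b' => [] [].
have /choice[j jP] : forall x, exists y, [/\ A y, A x -> x = y &
    forall nAx : (~` A) x, val (g (exist _ x (mem_set nAx))) = y].
  move=> x; have [Ax|nAx] := pselect (A x); first by exists x; split=> // nAx; case: (nAx Ax).
  exists (val (g (exist _ x (mem_set nAx)))); split=> [||nAx'].
      exact: set_mem (valP (g _)).
    by move=> /nAx.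
  by congr (val (g _)); exact: val_inj.
have jA x : A (j x) by have [] := jP x.
have jE x : A x -> j x = x by have [_ xj _] := jP x => /xj.
(* The map [j] is the identity on [A] and [g] off [A]; the tag separates the two cases, which makes
   [c] injective. *)
pose c x := f (t `[<A x>]) (j x).
have cA x : A (c x) by apply: (fA).
have injc : injective c.
  move=> x y /finj[]// /tinj; case: asboolP => [Ax|nAx]; case: asboolP => [Ay|nAy]// _.
    by rewrite !jE.
  by have [_ _ /(_ nAx)<-] := jP x; have [_ _ /(_ nAy)<-] := jP y => /val_inj/injg[].
by exists (fun p => f (c p.1) (c p.2)) => -[x y] [x' y'] /= /finj[]// /injc-> /injc->.
Qed.

Lemma card_le_infinite T U (A : set T) (B : set U) :
  A #<= B -> infinite_set A -> infinite_set B.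
Proof. by move=> AB infA /(card_le_finite AB). Qed.

Lemma card_leX T T' U U' (A : set T) (A' : set T') (B : set U) (B' : set U') :
  A #<= A' -> B #<= B' -> A `*` B #<= A' `*` B'.
Proof.
move=> /card_le_injP[f injf] /card_le_injP[g injg].
apply: (@card_le_rel _ _ _ _ (fun p q => exists (a : A) (b : B),
  [/\ p = (val a, val b) & q = (val (f a), val (g b))])).
  move=> [a b] [Aa Bb] /=.
  exists (val (f (exist _ a (mem_set Aa))), val (g (exist _ b (mem_set Bb)))).
  split; first by split; exact: set_mem (valP _).
  by do 2 eexists; split; last by [].
move=> p p' q _ _ [a [b [-> ->]]] [a' [b' [-> []]]].
by move=> /val_inj/injf-> /val_inj/injg->.
Qed.

Lemma card_setX_infinite T (A : set T) : infinite_set A -> A `*` A #<= A.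
Proof.
move=> infA; have /infinite_pairing[f injf] : infinite_set [set: A].
  by apply: card_le_infinite infA; rewrite (card_le_eqr (card_setT A)).
apply: (@card_le_rel _ _ _ _ (fun p c => exists a b : A,
  p = (val a, val b) /\ c = val (f (a, b)))).
  move=> [a b] [Aa Ab].
  exists (val (f (exist _ a (mem_set Aa), exist _ b (mem_set Ab)))).
  by split; [exact: set_mem (valP _)|do 2 eexists; split; last by []].
by move=> p p' c _ _ [a [b [-> ->]]] [a' [b' [-> /val_inj/injf[-> ->]]]].
Qed.

(** The product embeds in the square of the larger factor, which is infinite because [C] is, and so
    is equipotent to its square. *)
Lemma card_le_setX_infinite S T U (C : set S) (A : set T) (B : set U) :
  infinite_set C -> C #<= A `*` B -> C #<= A \/ C #<= B.
Proof.
have aux T1 T2 (X : set T1) (Y : set T2) : infinite_set C ->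
    C #<= X `*` X -> X #<= Y -> C #<= Y.
  move=> infC CX XY; have [finX|infX] := pselect (finite_set X).
    by case: infC; apply: card_le_finite CX _; exact: finite_setX.
  by apply: card_le_trans CX (card_le_trans (card_setX_infinite infX) XY).
move=> infC CAB; have [AB|BA] := card_le_total A B; [right|left].
  by apply: (aux _ _ B) (card_lexx _) => //; apply: card_le_trans CAB (card_leX _ _).
by apply: (aux _ _ A) (card_lexx _) => //; apply: card_le_trans CAB (card_leX _ _).
Qed.

Lemma card_seq_infinite T : infinite_set [set: T] -> [set: seq T] #<= [set: T].
Proof.
move=> infT; have [x0 _] := infinite_setN0 infT.
have /infiniteP/card_le_setTP[n injn] := infT.
have [f injf] := infinite_pairing infT.
(* [code] alone may identify sequences of different sizes. *)
pose code := foldr (fun x c => f (x, c)) x0.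
apply/card_le_setTP; exists (fun s => f (n (size s), code s)) => s s' /injf[/injn].
by elim: s s' => [|x s IHs] [|x' s']//= [/IHs eqs] /injf[-> /eqs->].
Qed.

(** * Spans, linear extensions and maximal subspaces *)

Section LinearAlgebra.
Variables (K : fieldType) (W : lmodType K).
Implicit Types (V B X F : set W) (l : seq (K * W)).

Lemma is_subspaceP V :
  is_subspace V <-> V 0 /\ forall a u v, V u -> V v -> V (a *: u + v).
Proof.
split=> -[V0 Vl]; split.
- exact: set_mem V0.
- by move=> a u v Vu Vv; apply: set_mem; apply: Vl; exact: mem_set.
- exact: mem_set.
- by move=> a u v /set_mem Vu /set_mem Vv; apply: mem_set; exact: Vl.
Qed.

(** Lists with possible repetitions make sums and multiples list operations, and [g] evaluates the
    same formal combination in another space. *)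
Definition lincomb (Z : lmodType K) (g : W -> Z) l := \sum_(p <- l) p.1 *: g p.2.

Lemma lincomb_cat (Z : lmodType K) (g : W -> Z) l l' :
  lincomb g (l ++ l') = lincomb g l + lincomb g l'.
Proof. by rewrite /lincomb big_cat. Qed.

Lemma lincomb_scale (Z : lmodType K) (g : W -> Z) a l :
  lincomb g [seq (a * p.1, p.2) | p <- l] = a *: lincomb g l.
Proof.
rewrite /lincomb big_map scaler_sumr; apply: eq_bigr => p _.
by rewrite scalerA.
Qed.

(** Collecting the coefficients of repeated vectors leads back to the duplicate-free sequences of
    [linearly_independent]. *)
Lemma lincomb_undup (Z : lmodType K) (g : W -> Z) l :
  lincomb g l = \sum_(v <- undup (map snd l)) (\sum_(p <- l | p.2 == v) p.1) *: g v.
Proof.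
under eq_bigr do rewrite scaler_suml.
rewrite (exchange_big_dep xpredT)//= /lincomb.
rewrite big_seq [RHS]big_seq; apply: eq_bigr => p pl.
under eq_bigl do rewrite eq_sym.
by rewrite -big_filter filter_pred1_uniq ?undup_uniq ?mem_undup ?map_f// big_seq1.
Qed.

Lemma linear_spanP B w :
  linear_span B w <-> exists2 l, (forall p, p \in l -> B p.2) & w = lincomb id l.
Proof.
split=> [[s [c [sB ->]]]|[l lB ->]].
  exists [seq (c v, v) | v <- s]; last by rewrite /lincomb big_map.
  by move=> p /mapP[v vs ->]; exact: sB.
exists (undup (map snd l)), (fun v => \sum_(p <- l | p.2 == v) p.1).
by split; [move=> v /=; rewrite mem_undup => /mapP[p /lB + ->]|exact: lincomb_undup].
Qed.

Lemma linear_span_subspace B : is_subspace (linear_span B).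
Proof.
apply/is_subspaceP; split; first by exists [::], (fun=> 0); rewrite big_nil.
move=> a u v /linear_spanP[l lB ->] /linear_spanP[l' lB' ->]; apply/linear_spanP.
exists ([seq (a * p.1, p.2) | p <- l] ++ l'); last by rewrite lincomb_cat lincomb_scale.
move=> p; rewrite mem_cat => /orP[/mapP[q /lB + ->]|/lB']; exact.
Qed.

Lemma sub_linear_span B : B `<=` linear_span B.
Proof.
move=> b Bb; exists [:: b], (fun=> 1).
by rewrite big_seq1 scale1r; split=> // x /=; rewrite inE => /eqP->.
Qed.

Lemma linear_span_min B V : is_subspace V -> B `<=` V -> linear_span B `<=` V.
Proof.
move=> /is_subspaceP[V0 Vl] BV _ [s [c [sB ->]]].
elim: s sB => [|v s IHs] sB; first by rewrite big_nil.
rewrite big_cons; apply: Vl; first by apply/BV/sB; rewrite /= mem_head.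
by apply: IHs => x xs; apply: sB; rewrite /= inE (xs : x \in s) orbT.
Qed.

(** All collected coefficients vanish, whatever [g] is. This makes the linear extension of a map on
    a basis well defined. *)
Lemma linearly_independent_lincomb (Z : lmodType K) (g : W -> Z) B l :
  linearly_independent B -> (forall p, p \in l -> B p.2) ->
  lincomb id l = 0 -> lincomb g l = 0.
Proof.
move=> indB lB; rewrite !lincomb_undup => l0.
rewrite big_seq big1// => v vl.
rewrite (indB _ _ (undup_uniq _) _ l0 v vl) ?scale0r// => x /=.
by rewrite mem_undup => /mapP[p /lB + ->].
Qed.

Lemma linear_extension (Z : lmodType K) B (h : W -> Z) : is_basis [set: W] B ->
  exists f : {linear W -> Z}, forall b, B b -> f b = h b.
Proof.
move=> [indB spanB].
have /choice[r rP] : forall w, exists l, (forall p, p \in l -> B p.2) /\ w = lincomb id l.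
  move=> w; have : linear_span B w by rewrite spanB.
  by move=> /linear_spanP[l]; exists l.
(* The difference of two representations of [w] is a relation among basis vectors, which [h]
   preserves. *)
have hE l w : (forall p, p \in l -> B p.2) -> w = lincomb id l -> lincomb h (r w) = lincomb h l.
  move=> lB wl; have [rB wr] := rP w; apply/eqP; rewrite -subr_eq0; apply/eqP.
  rewrite -[- _]scaleN1r -lincomb_scale -lincomb_cat.
  apply: (linearly_independent_lincomb _ indB).
    move=> p; rewrite mem_cat => /orP[/rB//|/mapP[q /lB + ->]]; exact.
  by rewrite lincomb_cat lincomb_scale scaleN1r -wl -wr subrr.
pose f w := lincomb h (r w).
have flin : linear f.
  move=> a u v; rewrite /f -lincomb_scale -lincomb_cat; have [[uB ur] [vB vr]] := (rP u, rP v).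
  apply: hE; last by rewrite lincomb_cat lincomb_scale -ur -vr.
  move=> p; rewrite mem_cat => /orP[/mapP[q /uB + ->]|/vB//]; exact.
pose fL : {linear W -> Z} := HB.pack f (GRing.isLinear.Build K W Z *:%R f flin).
exists fL => b Bb; rewrite /= /f (hE [:: (1, b)]) => [|p|]; rewrite ?inE.
- by rewrite /lincomb big_seq1 scale1r.
- by move=> /eqP->.
- by rewrite /lincomb big_seq1 scale1r.
Qed.

(** A vector of the span is determined by a finite sequence in [K * B], and there are at most [C]
    such sequences. *)
Lemma card_linear_span T (C : set T) B : infinite_set C -> B #<= C ->
  [set: K] #<= C -> linear_span B #<= C.
Proof.
move=> infC BC KC.
have /card_le_injP[f injf] : [set: K] `*` B #<= C.
  exact: card_le_trans (card_leX KC BC) (card_setX_infinite infC).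
apply: (@card_le_trans _ _ _ [set: seq C]); last first.
  rewrite -(card_le_eqr (card_setT C)); apply: card_seq_infinite.
  by apply: card_le_infinite infC; rewrite (card_le_eqr (card_setT C)).
apply: (@card_le_rel _ _ _ _ (fun w s => exists2 l : seq ([set: K] `*` B : set _),
   w = lincomb id (map val l) & s = map f l)).
  move=> w /linear_spanP[l lB ->].
  suff [l' ll'] : exists l' : seq ([set: K] `*` B : set _), l = map val l'.
    by exists (map f l'); split=> //; exists l'; rewrite ?ll'.
  elim: l lB => [|p l IHl] lB; first by exists [::].
  have [|l' ->] := IHl; first by move=> q ql; apply: lB; rewrite inE ql orbT.
  have Bp : ([set: K] `*` B) p by split=> //; apply: lB; rewrite mem_head.
  by exists (exist _ p (mem_set Bp) :: l').
by move=> w w' _ _ _ [l -> ->] [l' -> /(inj_map injf)->].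
Qed.

(* A maximal independent set spanning a subspace inside [F] is a basis of a
   maximal subspace of [F]. *)
Lemma maximal_subspace_exists F : F 0 ->
  exists V, maximal_subspace_in F V /\ exists B, is_basis V B.
Proof.
move=> F0; pose P B := linearly_independent B /\ linear_span B `<=` F.
have [G GP Gtot|B [[indB BF] maxB]] := @Zorn_bigcup _ P.
  (* A finite subset of the union of a chain lies in one member, unless it is empty. *)
  have chain s : [set` s] `<=` \bigcup_(X in G) X ->
      s = [::] \/ exists2 X, G X & [set` s] `<=` X.
    elim: s => [|v s IHs] sG; [by left|right].
    have [X GX Xv] := sG v (mem_head _ _).
    have [|->|[Y GY sY]] := IHs.
    - by move=> x xs; apply: sG; rewrite /= inE (xs : x \in s) orbT.
    - by exists X => // x; rewrite /= inE => /eqP->.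
    - have [XY|YX] := Gtot _ _ GX GY.
        by exists Y => // x; rewrite /= inE => /predU1P[->|/sY//]; exact: XY.
      by exists X => // x; rewrite /= inE => /predU1P[->//|/sY]; exact: YX.
  split=> [s c us /chain[->//|[X GX sX]]|w [s [c [/chain[->|[X GX sX]] ->]]]].
  - by have [indX _] := GP X GX; exact: indX.
  - by rewrite big_nil.
  - by have [_] := GP X GX; apply; exists s, c.
exists (linear_span B); split; last by exists B.
split=> // [|V Vsub VF BV]; first exact: linear_span_subspace.
apply/seteqP; split=> // v Vv; apply: contrapT => nBv.
case: (maxB (B `|` [set v])).
  split=> [|sub]; first exact: subsetUl.
  by apply/nBv/sub_linear_span/sub; right.
split; last first.
  apply: subset_trans VF; apply: linear_span_min => //.
  by move=> x [/sub_linear_span/BV//|->].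
move=> s c us sBv s0.
have sB x : x \in s -> x != v -> B x.
  by move=> xs xv; case: (sBv x xs) => // xv'; rewrite xv' eqxx in xv.
have [vs|nvs] := boolP (v \in s); last first.
  apply: indB => // x xs; apply: sB => //.
  by apply: contraNneq nvs => <-.
have remB : [set` rem v s] `<=` B.
  by move=> x /=; rewrite mem_rem_uniq// inE => /andP[xv xs]; exact: sB.
move: s0; rewrite (perm_big _ (perm_to_rem vs)) big_cons /= => s0.
have [cv0|cv0] := eqVneq (c v) 0.
  move: s0; rewrite cv0 scale0r add0r => s0 x xs.
  have [->//|xv] := eqVneq x v.
  by apply: (indB _ c (rem_uniq v us) remB s0); rewrite mem_rem_uniq// inE xv.
(* A nonzero coefficient at [v] allows the relation to be solved for [v], which puts [v] in the span
   of [B]. *)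
case: nBv; exists (rem v s), (fun x => - (c v)^-1 * c x); split=> //.
under eq_bigr do rewrite -scalerA; rewrite -scaler_sumr.
move/eqP: s0; rewrite addrC addr_eq0 => /eqP->.
by rewrite scalerN scaleNr opprK scalerA mulVf// scale1r.
Qed.

End LinearAlgebra.

(** * Spaces whose dimension exceeds the cardinality of the field *)

Section Dimension.
Variables (K : fieldType) (W : lmodType K) (d : Type) (B : set W).
Hypotheses (K_infinite : infinite_set [set: K]).
Hypotheses (Bbasis : is_basis [set: W] B) (Bd : B #= [set: d]).
Hypotheses (Kd : [set: K] #<= [set: d]) (ndK : ~ ([set: d] #<= [set: K])).

Let infd : infinite_set [set: d]. Proof. exact: card_le_infinite Kd K_infinite. Qed.

Lemma card_space_le : [set: W] #<= [set: d].
Proof.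
have [_ <-] := Bbasis; apply: card_linear_span => //.
by rewrite (card_le_eql Bd) card_lexx.
Qed.

(** A basis no larger than [K] would span at most [K] vectors, fewer than [d]; a larger one is
    infinite and bounds the cardinality of its span. *)
Lemma card_basis_ge (V X : set W) : is_basis V X -> [set: d] #<= V ->
  [set: d] #<= X.
Proof.
move=> [_ <-] dV; have [XK|KX] := card_le_total X [set: K].
  by case: ndK; apply: card_le_trans dV _; exact: card_linear_span.
by apply: card_le_trans dV _; apply: card_linear_span => //; exact: card_le_infinite KX _.
Qed.

Lemma linear_map_onto (Z : lmodType K) (U : set Z) : is_subspace U -> U #<= [set: d] ->
  exists (f : {linear W -> Z}) (s : Z -> W),
    [/\ forall w, U (f w), forall u, U u -> f (s u) = u
      & [set: d] #<= [set w | f w = 0]].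
Proof.
move=> Usub Ud; have /is_subspaceP[U0 Ulin] := Usub.
have dB : [set: d] #<= B by rewrite (card_le_eqr Bd) card_lexx.
have /infinite_pairing[p injp] : infinite_set [set: B].
  by apply: card_le_infinite infd; rewrite (card_le_eqr (card_setT B)).
have /card_le_injP[e inje] := card_le_trans Ud dB.
(* The basis vectors [p (e u, b)], with [b] in [B], form a fibre of size [d] over each [u]; all
   remaining vectors get the default value 0, which lies in [U]. *)
have /choice[h hP] : forall w, exists z, U z /\
    forall (u : U) (b : B), w = val (p (e u, b)) -> z = val u.
  move=> w; have [[u [b ->]]|no] := pselect (exists (u : U) (b : B), w = val (p (e u, b))).
    exists (val u); split=> [|u' b']; first exact: set_mem (valP u).
    by move=> /val_inj/injp[/inje->].
  by exists 0; split=> // u b wub; case: no; exists u, b.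
have hU w : U (h w) by have [] := hP w.
have [f fh] := linear_extension h Bbasis.
have fp (u : U) b : f (val (p (e u, b))) = val u.
  rewrite fh; last exact: set_mem (valP _).
  by have [_] := hP (val (p (e u, b))); apply.
have [b0 _] : [set: B] !=set0.
  by apply: infinite_setN0; apply: card_le_infinite infd; rewrite (card_le_eqr (card_setT B)).
have /choice[s sP] : forall z, exists w, U z -> f w = z.
  move=> z; have [Uz|nUz] := pselect (U z); last by exists 0.
  by exists (val (p (e (exist _ z (mem_set Uz)), b0))); rewrite fp.
exists f, s; split=> // [w|].
  have : linear_span B w by have [_ ->] := Bbasis.
  suff /linear_span_min : is_subspace (f @^-1` U).
    by apply=> b Bb /=; rewrite fh.
  apply/is_subspaceP; split=> [/=|a u v Uu Uv]; first by rewrite linear0.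
  by rewrite /= linearP; exact: Ulin.
apply: (card_le_trans dB); rewrite -(card_le_eql (card_setT B)).
apply: (card_le_inj (f := fun b => val (p (e (exist _ 0 (mem_set U0)), b)))).
  by move=> b _ /=; rewrite fp.
by move=> b b' _ _ /val_inj/injp[].
Qed.

Lemma maximal_lineability_invariant (F N : set W) : F 0 ->
  is_subspace N -> [set: d] #<= N -> (forall w n, F w -> N n -> F (w + n)) ->
  is_maximal_lineability_number F d.
Proof.
move=> F0 /is_subspaceP[N0 Nlin] dN FN.
have FE : F `|` [set 0] = F by apply/seteqP; split=> [x [//|->//]|x]; left.
have NV V : maximal_subspace_in F V -> N `<=` V.
  move=> [/is_subspaceP[V0 Vlin] VF maxV].
  (* [V + N] is again a subspace of [F]. *)
  pose V' := [set w | exists v n, [/\ V v, N n & w = v + n]].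
  have <- : V' = V; last by move=> n Nn; exists 0, n; rewrite add0r.
  apply: maxV.
  - apply/is_subspaceP; split; first by exists 0, 0; rewrite addr0.
    move=> a _ _ [v [n [Vv Nn ->]]] [v' [n' [Vv' Nn' ->]]].
    exists (a *: v + v'), (a *: n + n'); split; [exact: Vlin|exact: Nlin|].
    by rewrite scalerDr addrACA.
  - by move=> _ [v [n [/VF + + ->]]]; exact: FN.
  - by move=> v Vv; exists v, 0; rewrite addr0.
rewrite /is_maximal_lineability_number FE; split=> [|l [V [maxV [X [VX Xl]]]]]; last first.
  rewrite -(card_le_eqr Xl); apply: card_basis_ge VX _.
  by apply: card_le_trans dN _; apply: subset_card_le; exact: NV.
have [V [maxV [X VX]]] := maximal_subspace_exists F0.
exists V; split=> //; exists X; split=> //; rewrite card_eq_le; apply/andP; split.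
  exact: card_le_trans (card_leT X) card_space_le.
apply: card_basis_ge VX _.
by apply: card_le_trans dN _; apply: subset_card_le; exact: NV.
Qed.

(** Dimensions above [d] are excluded by the size of [W]. Every dimension up to [d] is realized by a
    subset of a basis of a maximal subspace. *)
Lemma lineability_successor (F : set W) s : is_maximal_lineability_number F d ->
  is_successor d s -> is_lineability_number F s.
Proof.
move=> [[V [[Vsub VF _] [X [[indX spanX] Xd]]]] _] [[ds nsd] smin].
split=> [[V' [_ _ [Y [_ Ys]]]]|l nl].
  apply: nsd; rewrite -(card_le_eql Ys).
  exact: card_le_trans (card_leT Y) card_space_le.
have nld : ~ ([set: l] #<= [set: d]).
  rewrite -(card_le_eqr Xd) => /card_le_injP[f injf]; apply: nl.
  pose Y := range (fun x => val (f x)).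
  have YX : Y `<=` X by move=> _ [x _ <-]; exact: set_mem (valP _).
  exists (linear_span Y); split; first exact: linear_span_subspace.
    apply: subset_trans VF; apply: linear_span_min => //.
    by rewrite -spanX; apply: subset_trans YX _; exact: sub_linear_span.
  exists Y; split.
    by split=> // t c ut tY; apply: indX => //; exact: subset_trans YX.
  have YT : Y #= [set: set_type [set: l]].
    by apply: inj_card_eq => x y _ _ /val_inj/injf.
  by rewrite (card_eql YT); exact: card_setT.
by apply: smin; split=> //; have [] := card_le_total [set: d] [set: l].
Qed.

End Dimension.

(** * Cones of prescribed additivity *)

(* The last two clauses say that the additivity of [C] in [U] is [kappa]. *)
Definition cone_of_additivity (K : fieldType) (Z : lmodType K) (U C : set Z)
    (kappa : Type) :=
  [/\ C 0, forall c z, c != 0 -> C z -> C (c *: z),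
      forall G, G `<=` U -> ~ ([set: kappa] #<= G) ->
        exists2 w, U w & forall g, G g -> C (w + g)
    & exists G, [/\ G `<=` U, G #= [set: kappa] &
        forall w, U w -> exists2 g, G g & ~ C (w + g)]].

(** * Transfer of a cone along a linear map with a section *)

Section Pullback.
Variables (K : fieldType) (W Z : lmodType K) (kappa : Type) (U C : set Z).
Variables (f : {linear W -> Z}) (s : Z -> W).
Hypotheses (fU : forall w, U (f w)) (sK : forall u, U u -> f (s u) = u).
Hypothesis Ckappa : cone_of_additivity U C kappa.

Lemma star_like_preimage : star_like (f @^-1` C).
Proof.
have [C0 CZ _ _] := Ckappa; apply/seteqP; split=> [w /(_ _ (oner_neq0 K))|w Cw c c0].
  by rewrite scale1r.
by rewrite /= linearZ; exact: CZ.
Qed.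

(** The section [s] lifts a family that no translation moves into [C], and it lifts the translation
    found for the image of a small family. The alternative value, the successor of [W], is at least
    [kappa]. *)
Lemma additivity_preimage : [set: kappa] #<= [set: W] ->
  is_additivity_number (f @^-1` C) kappa.
Proof.
move=> kW; have [C0 CZ Csmall [G [GU Gk Gbig]]] := Ckappa.
split=> [|l [[H [Hl Hbig]]|[[Wl _] _]]]; last exact: card_le_trans Wl.
  left; exists (s @` G); split.
    rewrite -(card_eqr Gk); apply: inj_card_eq => x y /set_mem Gx /set_mem Gy.
    by move=> /(congr1 f); rewrite !sK//; exact: GU.
  move=> w sub; have [g Gg] := Gbig _ (fU w); apply.
  have /sub : [set w + f | f in s @` G] (w + s g) by exists (s g) => //; exists g.
  by rewrite /= linearD sK//; exact: GU.
apply: contrapT => nkl; have [||u Uu uC] := Csmall (f @` H).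
- by move=> _ [x _ <-].
- move=> kH; apply: nkl; rewrite -(card_le_eqr Hl).
  exact: card_le_trans kH (card_image_le _ _).
apply: (Hbig (s u)) => _ [x Hx <-]; rewrite /= linearD sK//; apply: uC.
by exists x.
Qed.

End Pullback.

(** * The cones for small and for large additivity *)

Lemma cone_constants (K : fieldType) (J kappa : Type)
    (U := [set x : J -> K^o | ~ ([set: kappa] #<= range x)]) :
  [set: bool] #<= [set: kappa] -> [set: kappa] #<= [set: K] ->
  (forall T (A : set T), ~ ([set: kappa] #<= A) -> A #<= [set: J]) ->
  is_subspace U ->
  cone_of_additivity U [set x | U x /\ exists i, x i = 0] kappa.
Proof.
move=> k2 /card_le_setTP[j injj] Ik Usub; have /is_subspaceP[U0 Ulin] := Usub.
have UD x y : U x -> U y -> U (x + y) by rewrite -{2}[x]scale1r; exact: Ulin.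
have nk1 T (t : T) : ~ ([set: kappa] #<= [set t]).
  move=> k1; have /card_le_injP[h injh] := card_le_trans k2 k1.
  have : h (exist _ true (mem_set I)) = h (exist _ false (mem_set I)).
    by apply: val_inj; rewrite /= (set_mem (valP (h _))) (set_mem (valP (h _))).
  by move=> /injh.
(* As [kappa] is at least 2, a singleton is smaller than [kappa] and embeds in [J]. *)
have [i0] : exists i0 : J, True.
  have /card_le_injP[h _] := Ik _ _ (nk1 _ tt).
  by exists (val (h (exist _ tt (mem_set erefl)))).
move=> _; split.
- by split=> //; exists i0.
- move=> c x c0 [Ux [i xi]]; split; first by rewrite -[c *: x]addr0; exact: Ulin.
  by exists i; rewrite /GRing.scale/= xi; exact: mulr0.
- move=> G GU nkG; have /card_le_injP[e inje] := Ik _ _ nkG.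
  have [[g0 Gg0]|noG] := pselect (exists g, G g); last first.
    by exists 0 => // g Gg; case: noG; exists g.
  have /choice[r rP] : forall i, exists g : G, forall g' : G, i = val (e g') -> g' = g.
    move=> i; have [[g ->]|no] := pselect (exists g : G, i = val (e g)).
      by exists g => g' /val_inj/inje.
    by exists (exist _ g0 (mem_set Gg0)) => g' ig'; case: no; exists g'.
  have reK (g : G) : r (val (e g)) = g by exact/esym/rP.
  (* The translation [phi \o r] cancels [g] at its own point [e g]. It factors through [G], so its
     range is smaller than [kappa]. *)
  pose phi (g : G) : K := - val g (val (e g)).
  have Uw : U (fun i => phi (r i)).
    move=> kw; apply: nkG; rewrite -(card_le_eqr (card_setT G)).
    apply: card_le_trans kw (card_le_trans _ (card_image_le phi _)).
    by apply: subset_card_le => _ [i _ <-]; exists (r i).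
  exists (fun i => phi (r i)) => // g Gg; split; first by apply: UD => //; exact: GU.
  pose g' : G := exist _ g (mem_set Gg); exists (val (e g')).
  by rewrite /= [LHS]/GRing.add/= reK /phi /= addNr.
exists (range (fun k : kappa => (fun=> j k) : J -> K^o)); split.
- move=> _ [k _ <-] kr; apply: (nk1 _ (j k)); apply: card_le_trans kr _.
  by apply: subset_card_le => _ [i _ <-].
- by apply: inj_card_eq => k k' _ _ /(congr1 (fun x => x i0))/injj.
(* Otherwise [w] would take every value [- j k], too many for a member of [U]. *)
- move=> w Uw; apply: contrapT => nog; apply: Uw.
  apply: (card_le_inj (f := fun k => - j k)) => [k _|k k' _ _ /oppr_inj/injj//].
  apply: contrapT => nwk; apply: nog; exists (fun=> j k); first by exists k.
  move=> [_ [i wi]]; apply: nwk; exists i => //.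
  by apply/eqP; rewrite -addr_eq0; apply/eqP.
Qed.

(** The values of [a *: x + y] are determined by pairs in the product of the two ranges, and such a
    product stays below an infinite [kappa]. *)
Lemma function_subspace (K : fieldType) (I kappa : Type) :
  infinite_set [set: kappa] ->
  is_subspace [set x : I -> K^o | ~ ([set: kappa] #<= range x)].
Proof.
move=> infk; apply/is_subspaceP; split=> [k0|a x y nx ny kxy].
  apply: infk; apply: card_le_finite k0 _; apply: sub_finite_set (finite_set1 0).
  by move=> _ [i _ <-].
have : [set: kappa] #<= range x `*` range y.
  apply: card_le_trans kxy _; apply: (@card_le_rel _ _ _ _ (fun v p => v = a * p.1 + p.2)).
    by move=> _ [i _ <-]; exists (x i, y i); split=> //; split; exists i.
  by move=> v v' p _ _ -> ->.
by move=> /(card_le_setX_infinite infk)[].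
Qed.

(** A function is coded by its graph, a subset of [I * K], which embeds in [K]. The function space
    thus stays within the bound assumed on [d]. *)
Lemma card_functions (I K : Type) : infinite_set [set: K] -> [set: I] #<= [set: K] ->
  [set: I -> K] #<= [set: set K].
Proof.
move=> /infinite_pairing[p injp] /card_le_setTP[e inje].
apply/card_le_setTP; exists (fun x => [set k | exists i, k = p (e i, x i)]).
move=> x y xy; apply/funext => i.
have : [set k | exists i, k = p (e i, x i)] (p (e i, x i)) by exists i.
by rewrite xy => -[i' /injp[/inje-> ]].
Qed.

(** For finite [kappa], being smaller than [kappa] means having at most [kappa - 1] elements;
    [kappa] is positive, so the predecessor is not truncated. *)
Lemma predecessor_exists (kappa : Type) :
  finite_set [set: kappa] -> [set: bool] #<= [set: kappa] ->
  exists I : Type,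
   [/\ forall T (A : set T), ~ ([set: kappa] #<= A) -> A #<= [set: I],
       ~ ([set: kappa] #<= [set: I]) & [set: I] #<= [set: kappa]].
Proof.
move=> /finite_setP[n kn] k2.
have n0 : (0 < n)%N.
  rewrite lt0n; apply/eqP => n0; move: kn k2; rewrite n0 II0 card_eq0 => /eqP->.
  by rewrite card_le0 => /eqP/seteqP[/(_ true I)].
exists 'I_n.-1; split; rewrite ?(card_le_eqr kn) ?(card_le_eql kn).
- move=> T A; rewrite (card_le_eql kn) -(card_le_eqr card_II) => nA.
  have [//|An] := card_le_total `I_n A.
  have /finite_setP[m Am] := card_le_finite An (finite_II n).
  move: nA; rewrite (card_le_eqr Am) (card_le_eql Am) !card_le_II => /negP.
  by rewrite -ltnNge => mn; rewrite -ltnS prednK.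
- by rewrite -(card_le_eqr card_II) card_le_II -ltnS prednK// ltnn.
- by rewrite -(card_le_eql card_II) card_le_II leq_pred.
Qed.

Lemma cone_complement_line (K : fieldType) (Z : lmodType K) (kappa : Type)
    (B : set Z) (U := linear_span B) :
  infinite_set [set: K] -> ~ ([set: kappa] #<= [set: K]) ->
  linearly_independent B -> B #= [set: kappa] ->
  U #<= [set: kappa] /\
  exists C, cone_of_additivity U C kappa.
Proof.
move=> infK nkK indB Bk.
have Kk : [set: K] #<= [set: kappa] by have [] := card_le_total [set: K] [set: kappa].
have infk := card_le_infinite Kk infK.
have Uk : U #<= [set: kappa] by apply: card_linear_span; rewrite ?(card_le_eql Bk).
split=> //.
have kU : [set: kappa] #<= U.
  by rewrite -(card_le_eql Bk); apply: subset_card_le; exact: sub_linear_span.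
have /is_subspaceP[U0 Ulin] : is_subspace U by exact: linear_span_subspace.
have UD x y : U x -> U y -> U (x + y) by rewrite -{2}[x]scale1r; exact: Ulin.
have UZ c x : U x -> U (c *: x) by rewrite -[c *: x]addr0 => *; exact: Ulin.
have [u Bu] : B !=set0.
  by apply: infinite_setN0; apply: card_le_infinite infk; rewrite (card_le_eqr Bk).
have u0 : u != 0.
  apply/eqP => u0; have /eqP := oner_neq0 K; apply.
  apply: (indB [:: u] (fun=> 1) _ _ _ u) => //; rewrite ?mem_head//.
    by move=> x /=; rewrite inE => /eqP->.
  by rewrite big_seq1 u0 scaler0.
have Uu : U u by exact: sub_linear_span.
exists [set z | U z /\ forall c, c != 0 -> z <> c *: u]; split.
- split=> // c c0 /esym/eqP; rewrite scaler_eq0 (negPf c0) => /eqP u00.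
  by rewrite u00 eqxx in u0.
- move=> c z c0 [Uz zu]; split; first exact: UZ.
  move=> c' c'0 /(congr1 ( *:%R c^-1)); rewrite !scalerA mulVf// scale1r.
  by apply: zu; rewrite mulf_neq0 ?invr_eq0.
- move=> G GU nkG; apply: contrapT => now.
  (* A bad translation [w] satisfies [w + g = c *: u], so it is determined by the pair [(c, g)]. If
     all of [U] were bad, [kappa] would embed in [K] or in [G]. *)
  have : [set: kappa] #<= [set: K] `*` G.
    apply: card_le_trans kU _.
    apply: (@card_le_rel _ _ _ _ (fun w p => w + p.2 = p.1 *: u)) => [w Uw|].
      apply: contrapT => nop; apply: now; exists w => // g Gg; split.
        by apply: UD => //; exact: GU.
      by move=> c c0 wg; apply: nop; exists (c, g).
    by move=> w w' p _ _ <- /addIr.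
  by move=> /(card_le_setX_infinite infk)[].
(* The whole of [U] is the untranslatable family: [u - w] is moved by [w] onto [u]. *)
- exists U; split; rewrite ?card_eq_le ?Uk ?kU//.
  move=> w Uw; exists (u - w); first by rewrite -scaleN1r; apply: UD => //; exact: UZ.
  by rewrite addrC subrK => -[_ /(_ 1 (oner_neq0 K))]; rewrite scale1r.
Qed.

Theorem theorem2p5 (K : fieldType) (W : lmodType K) (d kappa : Type)
    (K_infinite : infinite_set [set: K])
    (dimW : has_dim [set: W] d)
    (dimW_ge : [set: set K] #<= [set: d])
    (kappa_ge2 : [set: bool] #<= [set: kappa])
    (kappa_le : [set: kappa] #<= [set: W]) :
  exists F : set W,
    [/\ star_like F, F `<` [set: W] & F 0] /\
    [/\ is_additivity_number F kappa,
        is_maximal_lineability_number F d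
      & exists s : Type, is_successor d s /\ is_lineability_number F s].
Proof.
have [B [Bbasis Bd]] := dimW.
have ndK : ~ ([set: d] #<= [set: K]).
  by move=> dK; apply: (@card_set_Nle K); exact: card_le_trans dimW_ge dK.
have Kd : [set: K] #<= [set: d] by have [] := card_le_total [set: K] [set: d].
have Wd := card_space_le K_infinite Bbasis Bd Kd.
have kd := card_le_trans kappa_le Wd.
suff [Z [U [C [Usub Ud Ck]]]] : exists (Z : lmodType K) (U C : set Z),
    [/\ is_subspace U, U #<= [set: d] & cone_of_additivity U C kappa].
  have [f [s [fU sK dker]]] := linear_map_onto K_infinite Bbasis Bd Kd Usub Ud.
  have [C0 CZ _ [G [GU _ Gbig]]] := Ck.
  have F0 : (f @^-1` C) 0 by rewrite /= linear0.
  have Fmax : is_maximal_lineability_number (f @^-1` C) d.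
    apply: (maximal_lineability_invariant K_infinite Bbasis Bd Kd ndK F0 _ dker).
      apply/is_subspaceP; split=> [|a u v /= fu fv]; first exact: linear0.
      by rewrite linearP fu fv scaler0 addr0.
    by move=> w n /= Cw fn; rewrite linearD fn addr0.
  exists (f @^-1` C); split; split=> //.
  - exact: star_like_preimage Ck.
  (* If the preimage were all of [W], then [C] would contain [U], and the translation by 0 would
     keep [G] inside [C]. *)
  - split=> // /(_ (s _) I) CT; have [U0 _] := (is_subspaceP U).1 Usub.
    have [g Gg] := Gbig 0 U0; apply; rewrite add0r.
    by have := CT g; rewrite /= sK//; exact: GU.
  - exact: additivity_preimage fU sK Ck _.
  - have [t dt] := successor_exists d; exists t; split=> //.
    exact: (lineability_successor K_infinite Bbasis Bd Kd Fmax).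
have [kK|nkK] := pselect ([set: kappa] #<= [set: K]); last first.
  have [e injE] : exists e : kappa -> B, injective e.
    have kB : [set: kappa] #<= B by rewrite (card_le_eqr Bd).
    have kB' : [set: kappa] #<= [set: B] by rewrite (card_le_eqr (card_setT B)).
    exact/card_le_setTP.
  pose B' := range (fun k => val (e k)).
  have indB' : linearly_independent B'.
    move=> t c ut tB'; apply: (proj1 Bbasis) => // x /tB'[k _ <-].
    exact: set_mem (valP _).
  have B'k : B' #= [set: kappa] by apply: inj_card_eq => x y _ _ /val_inj/injE.
  have [Uk [C Ck]] := cone_complement_line K_infinite nkK indB' B'k.
  exists W, (linear_span B'), C; split=> //; first exact: linear_span_subspace.
  exact: card_le_trans Uk kd.
have [I [Ik Usub IK]] : exists I : Type,
    [/\ forall T (A : set T), ~ ([set: kappa] #<= A) -> A #<= [set: I],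
        is_subspace [set x : I -> K^o | ~ ([set: kappa] #<= range x)]
      & [set: I] #<= [set: K]].
  have [fink|infk] := pselect (finite_set [set: kappa]); last first.
    exists kappa; split=> // [T A nkA|]; last exact: function_subspace.
    by have [] := card_le_total [set: kappa] A.
  have [I [Ik kI Ilek]] := predecessor_exists fink kappa_ge2.
  exists I; split=> //; last exact: card_le_trans Ilek kK.
  (* A function on [kappa - 1] points has fewer than [kappa] values, so here the subspace is the
     full function space. *)
  have Uall (x : I -> K^o) : ~ ([set: kappa] #<= range x).
    by move=> kx; apply: kI; exact: card_le_trans kx (card_image_le _ _).
  by apply/is_subspaceP; split=> *; exact: Uall.
pose U := [set x : I -> K^o | ~ ([set: kappa] #<= range x)].
exists (I -> K^o : lmodType K), U, [set x | U x /\ exists i, x i = 0].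
split; [exact: Usub| |exact: cone_constants].
apply: card_le_trans dimW_ge; apply: card_le_trans (card_functions K_infinite IK).
exact: card_leT.
Qed.
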